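(* (Primary decomposition) In a noetherian monoid, every ideal $I$ can be written as a finite intersection $I=\bigcap_i\mathfrak{q}_i$ of irreducible primary ideals $\mathfrak{q}_i$.
   Context: ''Monoid'' means commutative monoid $A$, written multiplicatively, with unit $1$ and a zero element $0$ satisfying $0a=0$. An ideal of $A$ is a subset $I\ni0$ with $AI\subseteq I$. $A$ is noetherian if it satisfies the ascending chain condition on ideals. A proper ideal $\mathfrak q$ is primary if $xy\in\mathfrak q$ implies $x\in\mathfrak q$ or $y^n\in\mathfrak q$ for some $n$. An ideal $I$ is irreducible if $I=J\cap K$ with $J,K$ ideals implies $I=J$ or $I=K$. The intersection of the empty family of ideals is $A$ (this covers the case $I=A$). *)

(* Defs.v *)
From HB Require Import structures.
From mathcomp Require Import all_boot all_classical.

Set Implicit Arguments.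
Unset Strict Implicit.
Unset Printing Implicit Defensive.

Local Open Scope classical_set_scope.
Local Open Scope group_scope.

(* The monoid 0 = 1 is allowed; its only ideal is setT. *)
HB.mixin Record Monoid_isComMonoid0 A of Monoid A := {
  zerog : A;
  mulgC : forall x y : A, x * y = y * x;
  mul0g : forall x : A, zerog * x = zerog
}.

#[short(type="comMonoid0Type")]
HB.structure Definition ComMonoid0 := {A of Monoid_isComMonoid0 A & Monoid A}.

Definition monoid_ideal (A : comMonoid0Type) (I : set A) : Prop :=
  I zerog /\ forall a x : A, I x -> I (a * x).

Definition noetherian_monoid (A : comMonoid0Type) : Prop :=
  forall J : nat -> set A,
    (forall n, monoid_ideal (J n)) -> (forall n, J n `<=` J n.+1) ->
  exists N, forall n, (N <= n)%N -> J n = J N.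

Definition primary_ideal (A : comMonoid0Type) (q : set A) : Prop :=
  [/\ monoid_ideal q, q <> setT
    & forall x y : A, q (x * y) -> q x \/ exists n : nat, q (y ^+ n)].

(* Properness is not part of irreducibility: setT is irreducible. *)
Definition irreducible_ideal (A : comMonoid0Type) (I : set A) : Prop :=
  monoid_ideal I /\
  forall J K : set A, monoid_ideal J -> monoid_ideal K ->
    I = J `&` K -> I = J \/ I = K.

(* Main.v *)
(** An irreducible proper ideal [q] is primary: if [x y] lies in [q], the ideals
    [(q : y^n)] increase with [n], hence stabilise at some [N], and then
    [q = (q ∪ Ax) ∩ (q ∪ Ay^N)]; irreducibility puts [x] or [y^N] in [q].
    Every ideal is a finite intersection of proper irreducible ideals by
    noetherian induction, since an ideal that is neither irreducible nor the
    whole monoid is the intersection of two strictly larger ones. *)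
Require Import Defs.
From mathcomp Require Import all_boot all_classical.

Local Open Scope classical_set_scope.

Section Ideals.

Local Open Scope group_scope.
Context {A : comMonoid0Type}.
Implicit Types (I J K q : set A) (x y : A).

Definition colon_ideal I y : set A := [set a | I (a * y)].

Lemma monoid_ideal_colon I y : monoid_ideal I -> monoid_ideal (colon_ideal I y).
Proof.
case=> I0 IM; split; first by rewrite /colon_ideal /= mul0g.
by move=> a x Ix; rewrite /colon_ideal /= -mulgA; exact: IM.
Qed.

(** Without addition a union of ideals is an ideal, so this is the ideal generated by [I] and
    [x]. *)
Definition adjoin_ideal I x : set A := I `|` range (fun a => a * x).

Lemma monoid_ideal_adjoin I x : monoid_ideal I -> monoid_ideal (adjoin_ideal I x).
Proof.
case=> I0 IM; split; first by left.
move=> a z [Iz|[b _ <-]]; first by left; exact: IM.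
by right; exists (a * b); rewrite ?mulgA.
Qed.

Lemma mem_adjoin_ideal I x : adjoin_ideal I x x.
Proof. by right; exists 1; rewrite ?mul1g. Qed.

Lemma irreducible_primary q : noetherian_monoid A -> q <> setT ->
  irreducible_ideal q -> primary_ideal q.
Proof.
move=> noethA qT [qI q_irr]; split=> // x y qxy; have [_ qM] := qI.
have [N stabN] : exists N, forall n, (N <= n)%N ->
    colon_ideal q (y ^+ n) = colon_ideal q (y ^+ N).
  apply: noethA => [n|n a]; first exact: monoid_ideal_colon.
  by rewrite /colon_ideal /= expgS mulgA [a * y]mulgC -mulgA; exact: qM.
have := q_irr _ _ (monoid_ideal_adjoin q x qI)
  (monoid_ideal_adjoin q (y ^+ N) qI).
case.
- apply/seteqP; split=> [z qz|z [[//|[b _ bxz]] [//|[a _ ayz]]]].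
    by split; left.
  (* Here [z = b * x = a * y ^+ N], so [a * y ^+ N.+1 = b * (x * y)] lies in [q]; stability at [N]
     brings [a * y ^+ N = z] back into [q]. *)
  have : colon_ideal q (y ^+ N.+1) a.
    rewrite /colon_ideal /= expgSr mulgA ayz -bxz -mulgA.
    exact: qM.
  by rewrite (stabN _ (leqnSn N)) /colon_ideal /= ayz.
- by move=> ->; left; exact: mem_adjoin_ideal.
- by move=> qE; right; exists N; rewrite qE; exact: mem_adjoin_ideal.
Qed.

(** A counterexample to [P] always has a strictly larger one above it; iterating a choice of these
    gives a chain that never stabilises. *)
Lemma noetherian_ideal_ind (P : set A -> Prop) : noetherian_monoid A ->
  (forall I, monoid_ideal I ->
    (forall J, monoid_ideal J -> I `<` J -> P J) -> P I) ->
  forall I, monoid_ideal I -> P I.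
Proof.
move=> noethA PS I idI; apply: contrapT => nPI.
pose bad J := monoid_ideal J /\ ~ P J.
(* Badness is put under the existential so that [f] is total; a set that is not bad gets itself as a
   dummy value. *)
have /choice[f fP] J : exists K, bad J -> bad K /\ J `<` K.
  have [[idJ nPJ]|] := pselect (bad J); last by exists J.
  apply: contrapT => nK; apply: nPJ; apply: PS => // K idK JK.
  by apply: contrapT => nPK; apply: nK; exists K.
have badf n : bad (iter n f I) by elim: n => // n /fP[].
have [|n|N stabN] := noethA (fun n => iter n f I).
- by move=> n; have [] := badf n.
- by have [_ /properW] := fP _ (badf n).
- have [_] := fP _ (badf N).
  by rewrite -iterS (stabN _ (leqnSn N)) => -[_]; apply.
Qed.

Definition finite_bigcap (P : set A -> Prop) I :=
  exists (n : nat) (q : 'I_n -> set A), (forall i, P (q i)) /\ I = \bigcap_i q i.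

(** The empty family is needed for the whole monoid, which is not primary. *)
Lemma finite_bigcapT P : finite_bigcap P setT.
Proof.
exists 0%N, (fun=> setT); split; first by case.
by apply/seteqP; split.
Qed.

Lemma finite_bigcap1 (P : set A -> Prop) I : P I -> finite_bigcap P I.
Proof.
move=> PI; exists 1%N, (fun=> I); split=> //.
by apply/seteqP; split=> [x Ix i _ //|x /(_ ord0)]; apply.
Qed.

Lemma finite_bigcapI P J K :
  finite_bigcap P J -> finite_bigcap P K -> finite_bigcap P (J `&` K).
Proof.
move=> [m [p [Pp ->]]] [n [q [Pq ->]]].
exists (m + n)%N,
  (fun i => match fintype.split i with inl j => p j | inr k => q k end).
split; first by move=> i; case: (fintype.split i).
apply/seteqP; split=> [x [px qx] i _|x pqx].
  by case: (fintype.split i) => j; [exact: px|exact: qx].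
split=> i _.
- by have := pqx (unsplit (inl i)) I; rewrite unsplitK.
- by have := pqx (unsplit (inr i)) I; rewrite unsplitK.
Qed.

End Ideals.

Theorem theorem1p3 (A : comMonoid0Type) (noethA : noetherian_monoid A)
    (I : set A) (idealI : monoid_ideal I) :
  exists (n : nat) (q : 'I_n -> set A),
    (forall i : 'I_n, irreducible_ideal (q i) /\ primary_ideal (q i)) /\
    I = \bigcap_i q i.
Proof.
rewrite -/(finite_bigcap (fun q => irreducible_ideal q /\ primary_ideal q) I).
move: I idealI; apply: noetherian_ideal_ind => // I idealI IH.
have [->|IT] := pselect (I = setT); first exact: finite_bigcapT.
have [irrI|] := pselect (irreducible_ideal I).
  by apply: finite_bigcap1; split=> //; exact: irreducible_primary.
(* By contraposition: if [I = J ∩ K] with both different from [I], both are strictly larger, and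
   joining their decompositions gives one of [I]. *)
apply: contra_notP => not_cap; split=> // J K idealJ idealK IJK.
apply: contrapT => /not_orP[IJ IK]; apply: not_cap.
rewrite [X in finite_bigcap _ X]IJK.
apply: finite_bigcapI; apply: IH => //; rewrite properEneq; split.
- exact/eqP.
- by rewrite IJK; exact: subIsetl.
- exact/eqP.
- by rewrite IJK; exact: subIsetr.
Qed.
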